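(* Let $k\ge 2$ and let $G=(V,E)$ be a complete $k$-partite graph with partition $V=V_1\cup\cdots\cup V_k$, where $n_i:=|V_i|\geq 1$ and $n_1\leq n_2\leq\cdots\leq n_k$ (two vertices are joined by exactly one edge if they lie in different parts, and are non-adjacent otherwise). Then $$\operatorname{tw}(G)=\operatorname{gon}(G)=n_1+\cdots+n_{k-1}.$$
   Context: Let $G=(V,E)$ be a finite connected loopless graph. For $u\ne v$ let $E(u,v)$ be the set of edges between $u$ and $v$. The Laplacian $Q(G)\in\mathbb{Z}^{V\times V}$ has $Q_{vv}=$ degree of $v$ and $Q_{uv}=-|E(u,v)|$ for $u\neq v$. A divisor on $G$ is a vector $D\in\mathbb{Z}^V$; its degree is $\deg(D)=\sum_{v\in V}D(v)$; it is effective if $D\ge 0$. Divisors $D,D'$ are equivalent, $D\sim D'$, if $D-D'=Q(G)x$ for some $x\in\mathbb{Z}^V$. The rank of $D$ is the largest integer $k$ such that $D-D'$ is equivalent to an effective divisor for every effective divisor $D'$ of degree $k$ (and $-1$ if $D$ is not equivalent to an effective divisor). Thus $D$ has positive rank if and only if for every $v\in V$ there is an effective divisor $D''\sim D$ with $D''(v)\ge 1$. The gonality is $$\operatorname{gon}(G)=\min\{k : \text{there is a divisor of degree } k \text{ on } G \text{ with positive rank}\}.$$ A (simple) graph $H$ is chordal if it has no induced cycle of length at least $4$. A chordal extension of $G=(V,E)$ is a chordal graph $H$ on the same vertex set $V$ in which any two vertices adjacent in $G$ are adjacent. With $\omega(H)$ the maximum size of a clique in $H$, the treewidth is $\operatorname{tw}(G)=-1+\min\{\omega(H)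 : H \text{ is a chordal extension of } G\}$. *)

(* Defs.v *)
From mathcomp Require Import all_boot all_order all_algebra.
From mathcomp Require Import boolp.

Set Implicit Arguments.
Unset Strict Implicit.
Unset Printing Implicit Defensive.

Import Order.TTheory GRing.Theory Num.Theory.
Local Open Scope ring_scope.

(* Parallel edges are allowed; [card_ends] rules out loops. *)
Record multigraph (V E : finType) := Multigraph {
  ends : E -> {set V};
  card_ends : forall e, #|ends e| = 2%N;
  vertex_gt0 : (0 < #|V|)%N;
  connected : forall u v, connect (fun x y => [exists e, ends e == [set x; y]]) u v
}.

Section Divisors.
Variables (V E : finType) (G : multigraph V E).

Definition edges (u v : V) : {set E} := [set e | ends G e == [set u; v]].

Definition degree (v : V) : nat := #|[set e | v \in ends G e]|.

Definition laplacian (u v : V) : int :=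
  if u == v then (degree v)%:Z else - (#|edges u v|)%:Z.

Definition laplacian_mul (x : {ffun V -> int}) : {ffun V -> int} :=
  [ffun v => \sum_u laplacian v u * x u].

Definition divisor := {ffun V -> int}.

Definition deg (D : divisor) : int := \sum_v D v.

Definition effective (D : divisor) : Prop := forall v, 0 <= D v.

Definition equivalent (D D' : divisor) : Prop :=
  exists x : {ffun V -> int}, D - D' = laplacian_mul x.

Definition equiv_effective (D : divisor) : Prop :=
  exists D' : divisor, effective D' /\ equivalent D D'.

Definition rank_cond (D : divisor) (k : nat) : Prop :=
  forall D' : divisor, effective D' -> deg D' = k%:Z -> equiv_effective (D - D').

Lemma edges_incident (u : V) :
  degree u = (\sum_(v | v != u) #|edges u v|)%N.
Proof.
rewrite /degree -sum1_card.
under [RHS]eq_bigr do rewrite -sum1_card.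
rewrite (exchange_big_dep (fun e => u \in ends G e)) /=; last first.
  by move=> v e _; rewrite inE => /eqP ->; rewrite set21.
rewrite (eq_bigl (fun e => u \in ends G e)); last by move=> e; rewrite inE.
apply: eq_bigr => e ue.
have /eqP/cards2P[a [b [ab eab]]] := card_ends G e.
have [w wu ew] : exists2 w, w != u & ends G e = [set u; w].
  move: ue; rewrite eab !inE => /orP[] /eqP ->.
    by exists b; rewrite // eq_sym.
  by exists a; rewrite // setUC.
rewrite (big_pred1 w) // => v; rewrite /= inE ew /=.
apply/idP/idP => [/andP[vu /eqP /setP /(_ v)]|/eqP ->]; last by rewrite wu eqxx.
by rewrite !inE eqxx orbT (negbTE vu).
Qed.

Lemma laplacian_colsum (u : V) : \sum_v laplacian v u = 0.
Proof.
rewrite (bigD1 u) //= {1}/laplacian eqxx edges_incident.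
rewrite (eq_bigr (fun v => - (#|edges u v|)%:Z)); last first.
  by move=> v vu; rewrite /laplacian (negbTE vu) /edges setUC.
by rewrite sumrN -natz natr_sum; under eq_bigr do rewrite natz; rewrite subrr.
Qed.

Lemma deg_sub (D D' : divisor) : deg (D - D') = deg D - deg D'.
Proof. by rewrite /deg -sumrB; apply: eq_bigr => v _; rewrite !ffunE. Qed.

Lemma deg_equivalent (D D' : divisor) : equivalent D D' -> deg D = deg D'.
Proof.
case=> x e; apply/eqP; rewrite -subr_eq0 -deg_sub e /deg; apply/eqP.
under eq_bigr do rewrite ffunE.
rewrite exchange_big big1 //= => u _.
by rewrite -mulr_suml laplacian_colsum mul0r.
Qed.

Lemma equiv_effective_deg (D : divisor) : equiv_effective D -> 0 <= deg D.
Proof. by case=> D' [eD' /deg_equivalent ->]; apply: sumr_ge0. Qed.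

Lemma rank_cond_bound (D : divisor) (k : nat) :
  `[< rank_cond D k >] -> (k <= `|deg D|)%N.
Proof.
move=> /asboolP cD; have /card_gt0P [v _] := vertex_gt0 G.
pose D' : divisor := [ffun w => if w == v then k%:Z else 0].
have dD' : deg D' = k%:Z.
  rewrite /deg (bigD1 v) //= ffunE eqxx big1 ?addr0 // => w wv.
  by rewrite ffunE (negbTE wv).
have eD' : effective D' by move=> w; rewrite ffunE; case: ifP.
have := equiv_effective_deg (cD D' eD' dD').
by rewrite deg_sub dD' subr_ge0; case: (deg D).
Qed.

Lemma equivalent_refl (D : divisor) : equivalent D D.
Proof.
exists 0; rewrite subrr; apply/ffunP => v; rewrite !ffunE big1 // => u _.
by rewrite ffunE mulr0.
Qed.

Lemma effective_equiv (D : divisor) : effective D -> equiv_effective D.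
Proof. by move=> eD; exists D; split=> //; apply: equivalent_refl. Qed.

Lemma rank_cond0 (D : divisor) :
  equiv_effective D -> exists k, `[< rank_cond D k >].
Proof.
move=> wD; exists 0%N; apply/asboolP => D' eD' /eqP.
rewrite /deg psumr_eq0 // => /allP zD'.
suff -> : D - D' = D by [].
apply/ffunP => v; rewrite !ffunE.
by rewrite (eqP (zD' v (mem_index_enum v))) subr0.
Qed.

Definition rank (D : divisor) : int :=
  match pselect (equiv_effective D) with
  | left wD => (ex_maxn (rank_cond0 wD) (@rank_cond_bound D))%:Z
  | right _ => -1
  end.

(* A divisor of positive rank has nonnegative degree, so the minimum may be
   taken over the natural numbers. *)
Definition gonality_cond (k : nat) : Prop :=
  exists D : divisor, deg D = k%:Z /\ 0 < rank D.

Lemma gonality_cond_ex : exists k, `[< gonality_cond k >].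
Proof.
pose D : divisor := [ffun=> 1].
have eD : effective D by move=> v; rewrite ffunE.
exists `|deg D|%N; apply/asboolP; exists D; split.
  by rewrite gez0_abs // sumr_ge0.
rewrite /rank; case: pselect => [wD|]; last by case; apply: effective_equiv.
case: ex_maxnP => m _ /(_ 1%N) m_ge1; rewrite ltz_nat; apply: m_ge1.
apply/asboolP => D' eD' dD'; apply: effective_equiv => v.
rewrite !ffunE subr_ge0 -[X in _ <= X]dD' /deg (bigD1 v) //= lerDl.
exact: sumr_ge0.
Qed.

Definition gonality : nat := ex_minn gonality_cond_ex.

End Divisors.

Section Treewidth.
Variable V : finType.

Definition simple_graph (h : rel V) : Prop := symmetric h /\ irreflexive h.

(* [next s x] is the cyclic successor of x in s. *)
Definition induced_cycle (h : rel V) (s : seq V) : Prop :=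
  uniq s /\ {in s &, forall x y, h x y = (y == next s x) || (x == next s y)}.

Definition chordal (h : rel V) : Prop :=
  simple_graph h /\ forall s, induced_cycle h s -> ~ (4 <= size s)%N.

Definition clique (h : rel V) (A : {set V}) : bool :=
  [forall x in A, forall y in A, (x != y) ==> h x y].

Definition clique_number (h : rel V) : nat :=
  (\max_(A : {set V} | clique h A) #|A|)%N.

Variables (E : finType) (G : multigraph V E).

Definition chordal_extension (h : rel V) : Prop :=
  chordal h /\ forall u v, edges G u v != set0 -> h u v.

Definition chordal_extension_clique_number (w : nat) : Prop :=
  exists2 h : rel V, chordal_extension h & clique_number h = w.

Lemma chordal_extension_ex :
  exists w, `[< chordal_extension_clique_number w >].
Proof.
pose h : rel V := [rel x y | x != y].
exists (clique_number h); apply/asboolP; exists h => //; split; first split.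
- by split=> x => [y|]; rewrite /h /= ?eqxx // eq_sym.
- move=> [|a [|b [|c [|d s]]]] // [us hs] _.
  move: us; rewrite /= !inE !negb_or => /andP[/and4P[ab ac ad _]].
  case/andP => /andP[bc _] _.
  have := hs a c; rewrite !inE !eqxx !orbT => /(_ isT isT); rewrite /h /=.
  rewrite ac eqxx (eq_sym c b) (negbTE bc) (eq_sym c a) (negbTE ac) eqxx.
  by rewrite (negbTE ad).
- move=> u v /set0Pn [e]; rewrite inE => /eqP eE /=; apply/eqP => uv.
  by have := card_ends G e; rewrite eE uv setUid cards1.
Qed.

(* V is nonempty, hence the minimum is at least 1 and nothing is truncated. *)
Definition treewidth : nat := (ex_minn chordal_extension_ex).-1.

End Treewidth.

Definition complete_multipartite (V E : finType) (G : multigraph V E)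
    (k : nat) (P : 'I_k -> {set V}) : Prop :=
  [/\ \bigcup_i P i = [set: V],
      forall i j, i != j -> [disjoint P i & P j]
    & forall i j u v, u \in P i -> v \in P j ->
        #|edges G u v| = (if i == j then 0%N else 1%N)].

(* Main.v *)
(** Let [s] be the number of vertices outside the last part.

    Gonality: if [D - D' = Q x] with [D], [D'] effective and distinct, then [D] has, at
    each vertex of the set [U] where [x] is maximal, at least as many chips as there are
    edges from it to the complement of [U]; hence [deg D] is at least the size of that
    cut.  A graph of diameter at most two has edge connectivity equal to its minimum
    degree, here [s].  Conversely, one chip on every vertex outside the last part has
    positive rank: firing every vertex but [v], with [v] in the last part, moves all
    chips to [v].

    Treewidth: two non-edges of a chordal extension in two different parts would span an
    induced 4-cycle, so all parts but one are cliques, and adding a vertex of the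
    remaining part gives a clique of size at least [s + 1].  Conversely, completing all
    parts but the last yields a split graph with clique number at most [s + 1]. *)

Require Import Defs.
From mathcomp Require Import all_boot all_order all_algebra.
From mathcomp Require Import boolp zify.

Set Implicit Arguments.
Unset Strict Implicit.
Unset Printing Implicit Defensive.

Import Order.TTheory GRing.Theory Num.Theory.

(** * Chip firing and divisors of positive rank *)

Section Chips.
Variables (V E : finType) (G : multigraph V E).
Local Open Scope ring_scope.

Lemma edgesC u v : edges G u v = edges G v u.
Proof. by apply/setP => e; rewrite !inE setUC. Qed.

Lemma edges_loop u : edges G u u = set0.
Proof.
apply/setP => e; rewrite !inE setUid; apply/eqP => eu.
by have := card_ends G e; rewrite eu cards1.
Qed.

(** Spreading the degree over the incident edges leaves only differences of [x], whose signs are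
    known wherever [x] is maximal. *)
Lemma laplacian_mulE x u :
  laplacian_mul G x u = \sum_w (#|edges G u w|)%:Z * (x u - x w).
Proof.
rewrite ffunE (bigD1 u) //= [RHS](bigD1 u) //= subrr mulr0 add0r.
rewrite {1}/laplacian eqxx edges_incident -natz natr_sum mulr_suml -big_split /=.
apply: eq_bigr => w wu; rewrite /laplacian eq_sym (negbTE wu) natz.
by rewrite mulNr mulrBr.
Qed.

Lemma equivalent_sym D D' : equivalent G D D' -> equivalent G D' D.
Proof.
case=> x e; exists (- x); rewrite -opprB e; apply/ffunP => v.
by rewrite !ffunE -sumrN; apply: eq_bigr => u _; rewrite ffunE mulrN.
Qed.

Lemma equivalent_trans D1 D2 D3 :
  equivalent G D1 D2 -> equivalent G D2 D3 -> equivalent G D1 D3.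
Proof.
case=> x ex [y ey]; exists (x + y).
rewrite -[D1](subrK D2) -addrA ex ey; apply/ffunP => v.
by rewrite !ffunE -big_split; apply: eq_bigr => u _; rewrite ffunE mulrDr.
Qed.

Lemma rank_gt0 D :
  equiv_effective G D -> rank_cond G D 1 -> 0 < rank G D.
Proof.
move=> wD r1; rewrite /rank; case: pselect => [wD'|//].
case: ex_maxnP => m _ /(_ 1%N) m_ge1; rewrite ltz_nat; apply: m_ge1.
exact/asboolP.
Qed.

(** The rank condition is tested on [m] chips at [v], with [m] the rank; these chips are then put
    back. *)
Lemma rank_gt0_chip D v : 0 < rank G D ->
  exists D', [/\ effective D', equivalent G D D' & 1 <= D' v].
Proof.
rewrite /rank; case: pselect => [wD|//]; case: ex_maxnP => m /asboolP rm _.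
rewrite ltz_nat => m_gt0.
pose C : divisor V := [ffun w => if w == v then m%:Z else 0].
have eC : effective C by move=> w; rewrite ffunE; case: ifP.
have dC : deg C = m%:Z.
  rewrite /deg (bigD1 v) //= ffunE eqxx big1 ?addr0 // => w wv.
  by rewrite ffunE (negbTE wv).
have [D' [eD' [x ex]]] := rm C eC dC.
exists (D' + C); split.
- by move=> w; rewrite !ffunE -[X in X <= _]addr0 lerD ?eD' //; case: ifP.
- by exists x; rewrite -ex opprD addrA addrAC.
- by rewrite !ffunE eqxx -[X in X <= _]add0r lerD ?eD' // lez_nat.
Qed.

(** * Edge cuts and the lower bound on the gonality *)

Definition cut_size (U : {set V}) : nat :=
  (\sum_(u in U) \sum_(w in ~: U) #|edges G u w|)%N.

Lemma cut_sizeC U : cut_size (~: U) = cut_size U.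
Proof.
rewrite /cut_size setCK exchange_big /=.
by apply: eq_bigr => u _; apply: eq_bigr => w _; rewrite edgesC.
Qed.

Lemma effective_equivalent_cut D D' :
  effective D -> effective D' -> equivalent G D D' -> D != D' ->
  exists U, [/\ U != set0, U != setT & (cut_size U)%:Z <= deg D].
Proof.
move=> eD eD' [x ex] DD'.
have /card_gt0P [v0 _] := vertex_gt0 G.
case: (@Order.TotalTheory.arg_maxP _ _ _ v0 predT x isT) => m _ max_m.
have {}max_m w : x w <= x m := max_m w isT.
pose U := [set u | x u == x m].
have Dx u : D u = D' u + \sum_w (#|edges G u w|)%:Z * (x u - x w).
  by rewrite -laplacian_mulE -ex !ffunE addrC subrK.
exists U; split.
- by apply/set0Pn; exists m; rewrite inE.
- apply: contraNneq DD' => UT; apply/eqP/ffunP => u.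
  have xm w : x w = x m by apply/eqP; have := in_setT w; rewrite -UT inE.
  by rewrite Dx big1 ?addr0 // => w _; rewrite !xm subrr mulr0.
(* Only the chips on [U] are kept. At [u] in [U], the term [D' u] and the edges inside [U] are
   dropped as nonnegative, and each edge leaving [U] accounts for at least one chip because [x] is
   integral. *)
rewrite /deg (bigID (mem U)) /= -[X in X <= _]addr0 lerD ?sumr_ge0 //.
rewrite /cut_size -natz natr_sum; apply: ler_sum => u; rewrite inE => /eqP xu.
rewrite Dx -[X in X <= _]add0r lerD ?eD' // natr_sum [X in _ <= X](bigID (mem (~: U))) /=.
rewrite -[X in X <= _]addr0 lerD //.
  apply: ler_sum => w; rewrite !inE => xw.
  rewrite natz -[X in X <= _]mulr1 ler_wpM2l // xu.
  by move: (max_m w); lia.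
by apply: sumr_ge0 => w _; rewrite mulr_ge0 // xu subr_ge0 max_m.
Qed.

(** An effective divisor with a chip on every vertex has degree at least [#|V|]. Otherwise, bringing
    a chip to an empty vertex yields a different equivalent effective divisor, and hence a cut that
    bounds the degree. *)
Lemma gonality_ge s : (s <= #|V|)%N ->
  (forall U, U != set0 -> U != setT -> (s <= cut_size U)%N) ->
  (s <= gonality G)%N.
Proof.
move=> sV sU; rewrite /gonality; case: ex_minnP => g /asboolP [D [dD rD]] _.
have /card_gt0P [v0 _] := vertex_gt0 G.
have [D0 [eD0 DD0 _]] := rank_gt0_chip v0 rD.
rewrite -lez_nat -dD (deg_equivalent DD0).
case: (boolP [forall v, 1 <= D0 v]) => [/forallP D0_ge1|].
  apply: le_trans (_ : (#|V|)%:Z <= _); first by rewrite lez_nat.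
  rewrite -natz -sumr_const; exact: ler_sum.
rewrite negb_forall => /existsP [v D0v].
have [D1 [eD1 DD1 D1v]] := rank_gt0_chip v rD.
have [||U [U0 UT cU]] // := @effective_equivalent_cut D0 D1 eD0 eD1.
- exact: equivalent_trans (equivalent_sym DD0) DD1.
- by apply: contraNneq D0v => ->.
by apply: le_trans cU; rewrite lez_nat sU.
Qed.

Definition neighbours (u : V) : {set V} := [set w | edges G u w != set0].

(** Neighbours of [u] outside [U] are paid for by the edges at [u]; those inside are among the other
    vertices of [U], each of which sends an edge out. *)
Lemma cut_size_ge_degree (U : {set V}) u : u \in U ->
  (forall x, x \in U -> exists2 w, w \notin U & w \in neighbours x) ->
  (#|neighbours u| <= cut_size U)%N.
Proof.
move=> uU out.
rewrite -(cardsID U) /cut_size (bigD1 u) //= addnC leq_add //.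
  rewrite -sum1_card big_mkcond [X in (_ <= X)%N]big_mkcond; apply: leq_sum => w _.
  rewrite !inE; case: (w \in U) => //=; case: ifP => //.
  by rewrite -card_gt0.
apply: (@leq_trans (#|U :\ u|)).
  apply/subset_leq_card/subsetP => w; rewrite !inE => /andP [uw ->].
  by rewrite andbT; apply: contraNneq uw => ->; rewrite edges_loop.
rewrite -sum1_card (eq_bigl (fun x => (x \in U) && (x != u))); last first.
  by move=> x; rewrite !inE andbC.
apply: leq_sum => x /andP [xU _]; have [w wU] := out x xU.
rewrite inE -card_gt0 => xw; rewrite (bigD1 w) ?inE //=.
exact: leq_trans (leq_addr _ _).
Qed.

(** If some [a] in [U] has no neighbour outside [U], then any [b] outside shares with [a] a
    neighbour, which must lie in [U]. So every vertex on one of the two sides of the cut has a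
    neighbour on the other side. *)
Lemma cut_size_diameter2 s :
  (forall u w, u != w -> w \notin neighbours u ->
     exists2 x, x \in neighbours u & x \in neighbours w) ->
  (forall u, (s <= #|neighbours u|)%N) ->
  forall U, U != set0 -> U != setT -> (s <= cut_size U)%N.
Proof.
move=> diam2 min_deg U /set0Pn [u uU] UT.
have /set0Pn [w wU] : ~: U != set0.
  by apply: contraNneq UT => UC; rewrite -(setCK U) UC setC0.
case: (boolP [forall x in U, [exists y in ~: U, y \in neighbours x]]).
  move=> /forall_inP outU; apply: leq_trans (min_deg u) _.
  apply: cut_size_ge_degree uU _ => x /outU /exists_inP [y yU xy].
  by exists y; rewrite // -in_setC.
case/forall_inPn => a aU /exists_inPn a_in.
rewrite -cut_sizeC; apply: leq_trans (min_deg w) _.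
apply: cut_size_ge_degree wU _ => b bU.
have ab : a != b by apply: contraTneq bU => <-; rewrite inE aU.
have [y ay by_] := diam2 a b ab (a_in b bU).
exists y => //; rewrite inE negbK; apply: contraTT ay => yU.
by apply: a_in; rewrite inE.
Qed.

(** * The upper bound on the gonality *)

Lemma gonality_le_independent (A : {set V}) : A != setT ->
  (forall u w, u \in A -> #|edges G u w| = (w \notin A)) ->
  (gonality G <= #|~: A|)%N.
Proof.
move=> AT edgesA.
have A_gt0 : (0 < #|~: A|)%N.
  by rewrite card_gt0; apply: contraNneq AT => A0; rewrite -(setCK A) A0 setC0.
pose D : divisor V := [ffun u => (u \notin A : nat)%:Z].
have eD : effective D by move=> u; rewrite ffunE.
have dD : deg D = #|~: A|%:Z.
  rewrite /deg -sum1_card -natz natr_sum [RHS]big_mkcond; apply: eq_bigr => u _.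
  by rewrite ffunE inE; case: (u \in A).
have equivD v : v \in A ->
    equivalent G D [ffun u => if u == v then #|~: A|%:Z else 0].
  (* Up to a constant, which the Laplacian kills, this is the indicator of all vertices but [v]. *)
  move=> vA; exists [ffun u => - (u == v : nat)%:Z]; apply/ffunP => u.
  rewrite laplacian_mulE !ffunE; case: eqVneq => [->|uv].
    rewrite vA sub0r -sum1_card -natz natr_sum -sumrN [LHS]big_mkcond.
    apply: eq_bigr => w _; rewrite edgesA // ?ffunE ?eqxx inE.
    by case: (boolP (w \in A)) => [|wA]; rewrite ?mul0r //; case: eqVneq wA => // ->; rewrite vA.
  rewrite (bigD1 v) //= big1 ?addr0 => [|w wv].
    rewrite ?ffunE ?eqxx ?(negbTE uv) edgesC edgesA //.
    by case: (u \in A).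
  by rewrite ?ffunE ?(negbTE wv) subrr mulr0.
rewrite /gonality; case: ex_minnP => g _; apply; apply/asboolP; exists D.
split=> //; apply: rank_gt0; first exact: effective_equiv eD.
move=> C eC dC.
have [v Cv] : exists v, 0 < C v.
  apply/existsP; apply: contraT; rewrite negb_exists => /forallP C_le0.
  have : deg C <= 0 by apply: sumr_le0 => v _; rewrite leNgt C_le0.
  by rewrite dC.
(* Here [c] counts the chips at [v], [d] those at another vertex and [r] the rest, so a test divisor
   of degree one is a single chip. *)
have sum1_int (c d r : int) :
  0 < c -> 0 <= d -> 0 <= r -> c + (d + r) = 1 -> c = 1 /\ d = 0 by lia.
have C_eq u : C u = (u == v : nat)%:Z.
  move: dC; rewrite /deg (bigD1 v) //=; case: eqVneq => [->|uv].
    rewrite -[X in _ + X]add0r => dC.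
    by have [|//] := sum1_int _ _ _ Cv (lexx 0) _ dC; apply: sumr_ge0.
  rewrite (bigD1 u) //= => dC.
  by have [|//] := sum1_int _ _ _ Cv (eC u) _ dC; apply: sumr_ge0.
case: (boolP (v \in A)) => vA; last first.
  apply: effective_equiv => u; rewrite !ffunE C_eq.
  by case: eqVneq => [->|_]; rewrite ?vA ?subr0.
have [x ex] := equivD v vA.
(* All chips are gathered at [v]; there is at least one since [A] is not the whole vertex set, so
   one can be removed. *)
exists ([ffun u => if u == v then #|~: A|%:Z else 0] - C); split.
  by move=> u; rewrite !ffunE C_eq; case: eqVneq => // _; rewrite subr_ge0 lez_nat.
by exists x; rewrite -ex opprB addrA subrK.
Qed.

End Chips.

(** * Chordal graphs and split graphs *)

Section Chordal.
Variable V : finType.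

Lemma clique_number_ge (h : rel V) A : clique h A -> #|A| <= clique_number h.
Proof. by move=> hA; rewrite /clique_number (bigD1 A) //= leq_maxl. Qed.

Lemma chordal_no_square (h : rel V) a b c d : chordal h ->
  h a b -> h b c -> h c d -> h d a -> a != c -> b != d ->
  ~~ h a c -> ~~ h b d -> False.
Proof.
move=> [[sym irr] noC] ab bc cd da ac bd nac nbd.
have neq x y : h x y -> (x == y) = false.
  by move=> xy; apply: contraTF xy => /eqP ->; rewrite irr.
have eqC (x y : V) : (x == y) = false -> (y == x) = false by rewrite eq_sym.
have [[[nab nbc] ncd] nda] := (neq _ _ ab, neq _ _ bc, neq _ _ cd, neq _ _ da).
(* A table of all inequalities among the four vertices, from which [next] can be computed. *)
have neqE := (nab, nbc, ncd, nda, negbTE ac, negbTE bd, eqC _ _ nab, eqC _ _ nbc,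
  eqC _ _ ncd, eqC _ _ nda, eqC _ _ (negbTE ac), eqC _ _ (negbTE bd)).
have ind : induced_cycle h [:: a; b; c; d].
  split; first by rewrite /= !inE !neqE.
  have hE := (ab, bc, cd, da, negbTE nac, negbTE nbd).
  have hC x y : h x y = h y x by apply: sym.
  have hE' := (hC b a, hC c b, hC d c, hC a d, hC c a, hC d b).
  move=> x y; rewrite !inE.
  by do 2![case/or4P => /eqP ->]; rewrite /= ?irr ?hE ?hE' ?hE ?eqxx ?neqE ?eqxx ?neqE.
exact: noC ind isT.
Qed.

Definition split_rel (A : {set V}) : rel V :=
  fun u v => (u != v) && ~~ ((u \in A) && (v \in A)).

(** In an induced cycle starting [a, b, c, d], the nonadjacent pairs [a, c] and [b, d] both lie in
    [A]; then [a] and [b] are consecutive, yet nonadjacent. *)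
Lemma split_rel_chordal A : chordal (split_rel A).
Proof.
split; first by split=> [x y|x]; rewrite /split_rel ?eqxx // eq_sym [(x \in A) && _]andbC.
move=> [|a [|b [|c [|d s]]]] // [us hs] _.
move: us; rewrite /= !inE !negb_or.
case/andP => /and4P [ab ac ad aS] /andP [/and3P [bc bd bS] /andP [/andP [cd cS] /andP [dS _]]].
have nadj x y : x \in [:: a, b, c, d & s] -> y \in [:: a, b, c, d & s] ->
    x != y -> (y == next [:: a, b, c, d & s] x) = false ->
    (x == next [:: a, b, c, d & s] y) = false -> (x \in A) && (y \in A).
  move=> xs ys xy nx ny; have := hs x y xs ys.
  by rewrite nx ny /split_rel xy /= => /negbFE.
have /andP [aA _] : (a \in A) && (c \in A).
  apply: nadj; rewrite ?inE ?eqxx ?orbT //=.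
    by rewrite eqxx eq_sym (negbTE bc).
  by rewrite (eq_sym c a) (negbTE ac) (eq_sym c b) (negbTE bc) eqxx (negbTE ad).
have /andP [bA _] : (b \in A) && (d \in A).
  apply: nadj; rewrite ?inE ?eqxx ?orbT //=.
    by rewrite (eq_sym b a) (negbTE ab) eqxx eq_sym (negbTE cd).
  rewrite (eq_sym d a) (negbTE ad) (eq_sym d b) (negbTE bd) (eq_sym d c) (negbTE cd).
  (* The successor of [d] is [a] when the cycle has length four, and the next listed vertex
     otherwise. *)
  case: s bS {hs aS dS cS} => [|e s] /=; rewrite ?eqxx ?inE ?negb_or.
    by rewrite eq_sym (negbTE ab).
  by case/andP => /negbTE.
have := hs a b; rewrite !inE !eqxx !orbT /= eqxx => /(_ isT isT).
by rewrite /split_rel aA bA andbF ?eqxx /= ?eqxx.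
Qed.

(** A clique meets the independent set [A] in at most one vertex. *)
Lemma clique_number_split_rel A : clique_number (split_rel A) <= #|~: A|.+1.
Proof.
apply/bigmax_leqP => K /forall_inP clK; rewrite -(cardsID A K) -addn1 addnC.
apply: leq_add; first by apply/subset_leq_card/subsetP => x; rewrite !inE => /andP [].
apply/card_le1_eqP => x y; rewrite !inE => /andP [xK xA] /andP [yK yA].
apply/eqP; apply: contraT => yx.
by have /forall_inP /(_ y yK) := clK x xK; rewrite eq_sym yx /split_rel xA yA andbF.
Qed.

End Chordal.

(** * Complete multipartite graphs, with the partition encoded by the map [p] to part indices *)

Section Multipartite.
Variables (V E I : finType) (G : multigraph V E) (p : V -> I).
Hypothesis edgesE : forall u v, #|edges G u v| = (p u != p v).

Let part i := [set v | p v == i].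

Lemma multipartite_adjacent (h : rel V) u v :
  chordal_extension G h -> p u != p v -> h u v.
Proof. by case=> _ hG puv; apply: hG; rewrite -card_gt0 edgesE puv. Qed.

Lemma multipartite_chordal_clique (h : rel V) :
  (forall i, part i != set0) -> (exists i j : I, i != j) ->
  chordal_extension G h ->
  exists i, #|~: part i| < clique_number h.
Proof.
move=> part_neq0 [i0 _] hG; have [ch _] := hG; have [[sym _] _] := ch.
(* [j] is the only part that may fail to be a clique of [h]; if none fails, the arbitrary index [i0]
   serves. *)
have [j cl_j] : exists j, forall u v,
    p u = p v -> p u != j -> u != v -> h u v.
  case: (boolP [exists u, exists v, [&& p u == p v, u != v & ~~ h u v]]).
    case/existsP=> a /existsP [b /and3P [/eqP pab ab nab]].
    exists (p a) => u v puv pua uv; apply: contraT => nuv.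
    have adj := multipartite_adjacent hG.
    (* The missing edges [a b] and [u v] are the diagonals of a square whose sides join different
       parts. *)
    case: (@chordal_no_square _ h a u b v ch) => //; apply: adj => //.
    - by rewrite eq_sym.
    - by rewrite -pab.
    - by rewrite -pab -puv eq_sym.
    - by rewrite -puv.
  rewrite negb_exists => /forallP none; exists i0 => u v puv _ uv.
  have := none u; rewrite negb_exists => /forallP /(_ v).
  by rewrite puv eqxx uv negbK.
exists j; have /set0Pn [w] := part_neq0 j; rewrite inE => /eqP pw.
have wC : w \notin ~: part j by rewrite !inE pw eqxx.
have := cardsU1 w (~: part j); rewrite wC add1n => <-.
apply: clique_number_ge.
apply/forall_inP => u; rewrite !inE => uK; apply/forall_inP => v.
rewrite !inE => vK; apply/implyP => uv.
case: (eqVneq (p u) (p v)) => puv; last exact: multipartite_adjacent.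
case: (eqVneq (p u) j) => puj; last exact: cl_j.
move: uK vK; rewrite -puv puj eqxx !orbF => /eqP uw /eqP vw.
by rewrite uw vw eqxx in uv.
Qed.

(** The last two hypotheses characterise [s] as the least size of the complement of a part, without
    ordering the parts. *)
Lemma multipartite_treewidth s :
  (forall i, part i != set0) -> (exists i j : I, i != j) ->
  (forall i, s <= #|~: part i|) -> (exists i, #|~: part i| = s) ->
  treewidth G = s.
Proof.
move=> part_neq0 I2 s_le [i Ds]; rewrite /treewidth.
case: ex_minnP => w /asboolP [h hG hw] w_min.
suff -> : w = s.+1 by [].
apply/eqP; rewrite eqn_leq; apply/andP; split.
  rewrite -Ds; apply: leq_trans (clique_number_split_rel (part i)).
  apply: w_min; apply/asboolP; exists (split_rel (part i)) => //.
  split; first exact: split_rel_chordal.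
  move=> u v; rewrite -card_gt0 edgesE lt0b => puv; rewrite /split_rel !inE.
  apply/andP; split; first by apply: contraNneq puv => ->.
  by apply: contra puv => /andP [/eqP -> /eqP ->].
have [j] := multipartite_chordal_clique part_neq0 I2 hG.
by rewrite hw; apply: leq_ltn_trans.
Qed.

Lemma multipartite_gonality s :
  (forall i, part i != set0) -> (exists i j : I, i != j) ->
  (forall i, s <= #|~: part i|) -> (exists i, #|~: part i| = s) ->
  gonality G = s.
Proof.
move=> part_neq0 [i0 [j0 ij0]] s_le [i Ds].
have nbrE u : neighbours G u = ~: part (p u).
  by apply/setP => w; rewrite !inE -card_gt0 edgesE lt0b eq_sym.
apply/eqP; rewrite eqn_leq; apply/andP; split.
  rewrite -Ds; apply: gonality_le_independent.
    have [j ij] : exists j, j != i.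
      by case: (eqVneq i0 i) ij0 => [<-|]; [exists j0; rewrite eq_sym | exists i0].
    have /set0Pn [w] := part_neq0 j; rewrite inE => /eqP pw.
    by apply: contraNneq ij => /setP /(_ w); rewrite !inE pw.
  by move=> u w; rewrite !inE => /eqP pu; rewrite edgesE pu eq_sym.
apply: gonality_ge; first by rewrite -Ds max_card.
apply: cut_size_diameter2 => [u w uw|u]; last by rewrite nbrE.
rewrite !nbrE !inE negbK => /eqP pwu.
(* Distinct nonadjacent vertices share a part, so any vertex of another part is a common
   neighbour. *)
have [j ju] : exists j, j != p u.
  by case: (eqVneq i0 (p u)) ij0 => [<-|]; [exists j0; rewrite eq_sym | exists i0].
have /set0Pn [x] := part_neq0 j; rewrite inE => /eqP px.
by exists x; rewrite !inE ?pwu px.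
Qed.

End Multipartite.

(** * From an indexed family of parts to a map, and the final count *)

Lemma complete_multipartite_part (V E : finType) (G : multigraph V E) k
    (P : 'I_k -> {set V}) : complete_multipartite G P ->
  exists p : V -> 'I_k, (forall i, P i = [set v | p v == i]) /\
    forall u v, #|edges G u v| = (p u != p v).
Proof.
case=> coverP disjP edgesP.
have inP v : exists i, v \in P i.
  by have := in_setT v; rewrite -coverP => /bigcupP [i _ vi]; exists i.
(* [p] chooses a part containing each vertex; disjointness makes it the only one. *)
have [p pP] := choice inP; exists p; split=> [i|u v]; last first.
  by rewrite (edgesP _ _ _ _ (pP u) (pP v)); case: eqP.
apply/setP => v; rewrite inE; apply/idP/eqP => [vi|<-//].
apply/eqP; apply: contraT => /disjP /disjoint_setI0 /setP /(_ v).
by rewrite !inE pP vi.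
Qed.

Theorem mainTheorem2 (V E : finType) (G : multigraph V E) (k : nat)
    (P : 'I_k -> {set V}) (hk : 2 <= k)
    (hP : complete_multipartite G P)
    (hpos : forall i : 'I_k, 1 <= #|P i|)
    (hmono : forall i j : 'I_k, i <= j -> #|P i| <= #|P j|) :
  treewidth G = gonality G /\
  gonality G = \sum_(i < k | i < k.-1) #|P i|.
Proof.
have [p [PE edgesE]] := complete_multipartite_part hP.
case: k hk P hP hpos hmono p PE edgesE => [//|k] k_gt0 P _ hpos hmono p PE edgesE.
have cardP i : #|P i| = \sum_(v | p v == i) 1.
  by rewrite PE -sum1_card; apply: eq_bigl => v; rewrite inE.
(* With [k.+1] parts the largest is indexed by [ord_max]; its complement is counted part by part. *)
have sumE : \sum_(i < k.+1 | i < k) #|P i| = #|~: P ord_max|.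
  rewrite -sum1_card (partition_big p (fun i : 'I_k.+1 => i < k)) /=; last first.
    move=> v; rewrite PE !inE -val_eqE /= => pv.
    by rewrite ltn_neqAle pv -ltnS ltn_ord.
  apply: eq_bigr => i i_lt; rewrite cardP; apply: eq_bigl => v.
  rewrite PE !inE andbC; case: eqP => //= ->.
  by rewrite -val_eqE /= neq_ltn i_lt.
have part_neq0 i : [set v | p v == i] != set0 by rewrite -PE -card_gt0.
have I2 : exists i j : 'I_k.+1, i != j.
  by exists ord0, ord_max; rewrite -val_eqE /= eq_sym -lt0n.
(* The largest part has the smallest complement. *)
have s_le i : #|~: P ord_max| <= #|~: [set v | p v == i]|.
  have := hmono i ord_max (ltn_ord i : i <= k).
  by rewrite -PE; have := cardsC (P i); have := cardsC (P ord_max); lia.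
have s_eq : exists i, #|~: [set v | p v == i]| = #|~: P ord_max|.
  by exists ord_max; rewrite -PE.
rewrite sumE (multipartite_gonality edgesE part_neq0 I2 s_le s_eq).
by rewrite (multipartite_treewidth edgesE part_neq0 I2 s_le s_eq).
Qed.
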